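(* Let $k$ be a field of characteristic $0$, let $P$ be a locally finite poset viewed as a category, let $kP$ be its incidence algebra, and let $S\subseteq kP$ be the subalgebra generated by the identity morphisms in $P$. Let $\Phi: C^\bullet(P;k)\to C^\bullet(kP,S;kP)$ be defined by $$\Phi f=\sum_{i\in P} f(i)E^{ii}\quad\text{for } f\in C^0(P;k),$$ $$(\Phi f)(E^{i_0i_1},\ldots,E^{i_{n-1}i_n})=f(i_0,\ldots,i_n)E^{i_0i_n}\quad\text{for } f\in C^n(P;k),\ n>0.$$ Then $\Phi$ is an isomorphism of operads with multiplication from $(C^\bullet(P;k),m_{\mathrm S})$ to $(C^\bullet(kP,S;kP),m_{\mathrm H})$; that is, $\Phi$ is an isomorphism of operads and $\Phi(m_{\mathrm S})=m_{\mathrm H}$.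
   Context: A poset $P$ is locally finite if $\{x\in P\mid x_1\le x\le x_2\}$ is finite for all $x_1,x_2\in P$. View $P$ as a category whose objects are the elements of $P$, with a unique morphism $E^{ij}$ from $i$ to $j$ whenever $i\le j$. The incidence algebra $kP$ is the category algebra of $P$ over $k$: its elements are formal sums $\sum_{i\le j} r_{ij}E^{ij}$ with $r_{ij}\in k$, and the product is defined on generators by $E^{ij}E^{jl}=E^{il}$ and $E^{ij}E^{i'l}=0$ for $j\neq i'$. $S$ is the subalgebra of $kP$ generated by the identity morphisms $E^{ii}$, $i\in P$. Operads are non-$\Sigma$ operads of $k$-vector spaces $\mathcal{O}(n)$, $n\in\mathbb{N}=\{0,1,\ldots\}$, with compositions $\gamma:\mathcal{O}(r)\otimes\mathcal{O}(n_1)\otimes\cdots\otimes\mathcal{O}(n_r)\to\mathcal{O}(n_1+\cdots+n_r)$ and an identity $\mathrm{id}\in\mathcal{O}(1)$ satisfying the usual identity and associativity axioms; $\gamma(x;\ )=x$ for $x\in\mathcal{O}(0)$. Morphisms preserve identity and compositions. For $f\in\mathcal{O}(p)$, $p\ge 1$, $g\in\mathcal{O}(q)$, $1\le j\le p$, put $f\circ_j g=\gamma(f;\mathrm{id},\ldots,\mathrm{id},g,\mathrm{id},\ldots,\mathrm{id})$ with $g$ in the $j$-th input. A multiplication on $\mathcal{O}$ is an element $m\in\mathcal{O}(2)$ (regarded in the shifted space $\mathcal{O}[1]$) with $m\circ m=0$, where $m\circ m=m\circ_1m-m\circ_2m$. An operad with multiplication is an operad with a chosen multiplication. Simplicial cochains: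 $C^\bullet(P;k)$ is the simplicial cochain complex of the nerve of $P$; $C^n(P;k)$ is the space of $k$-valued functions on the $n$-simplices $(v_0,\ldots,v_n)$, $v_0\le\cdots\le v_n$, of the nerve. It is an operad, with $n$-th component $C^n(P;k)$ and identity the constant 1-cochain $1$, via, for $\varphi\in C^r$, $\varphi_i\in C^{n_i}$, $$\gamma(\varphi;\varphi_1,\ldots,\varphi_r)(v_0,\ldots,v_{n_1+\cdots+n_r})=\varphi(v_0,v_{n_1},v_{n_1+n_2},\ldots,v_{n_1+\cdots+n_r})\,\varphi_1(v_0,\ldots,v_{n_1})\,\varphi_2(v_{n_1},\ldots,v_{n_1+n_2})\cdots\varphi_r(v_{n_1+\cdots+n_{r-1}},\ldots,v_{n_1+\cdots+n_r}).$$ Its multiplication is the constant 2-cochain $m_{\mathrm S}(v_0,v_1,v_2)=1$. Relative Hochschild cochains: for an associative unital $k$-algebra $A$ and a subalgebra $S$, $C^n(A,S;A)$, $n>0$, is the space of $k$-multilinear $f:A^n\to A$ with $f(ba_1,\ldots,a_n)=bf(a_1,\ldots,a_n)$, $f(\ldots,a_ib,a_{i+1},\ldots)=f(\ldots,a_i,ba_{i+1},\ldots)$ for $1\le i<n$, and $f(a_1,\ldots,a_nb)=f(a_1,\ldots,a_n)b$ for all $a_1,\ldots,a_n\in A$, $b\in S$; and $C^0(A,S;A)=\{a\in A\mid ab=ba \text{ for all } b\in S\}$. It is an operad under the usual composition of multilinear maps, $\gamma(f;f_1,\ldots,f_r)=f(f_1(\ldots),\ldots,f_r(\ldots))$, with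 identity $\mathrm{id}_A$, and has the multiplication $m_{\mathrm H}(a_1,a_2)=a_1a_2$. In degree $n>0$, $\Phi f$ is specified by its values on composable tuples of morphisms ($i_0\le i_1\le\cdots\le i_n$) as displayed.
   Formalization: The subalgebra S generated by the identity morphisms is taken to allow infinite formal sums, so S consists of all sums of r_i E^{ii}; with only finite combinations the claim fails for P = Z, and for finite P the two readings agree. *)

(* Defs.v *)
From HB Require Import structures.
From mathcomp Require Import all_boot all_order all_algebra.
From mathcomp Require Import all_classical.

Set Implicit Arguments.
Unset Strict Implicit.
Unset Printing Implicit Defensive.

Import Order.TTheory GRing.Theory.

Local Open Scope classical_set_scope.
Local Open Scope ring_scope.

(* Equality of [x : O m] and [y : O n] up to transport along [m = n] ([nat] has
   unique identity proofs); needed since, e.g., [\sum_(i < 1) n] and [n] are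
   not convertible. *)
Definition same_op (O : nat -> Type) m n (x : O m) (y : O n) : Prop :=
  existT O m x = existT O n y.

(* [tagnat.sig1 s] and [tagnat.sig2 s] are the block, and the position in it,
   of the [s]-th of the [n_0 + ... + n_(r-1)] concatenated inputs.
   [op_gamma_idr] at [r = 0] is the convention [gamma (x; ) = x]. *)
Record operad (k : fieldType) := Operad {
  op_comp :> nat -> lmodType k;
  op_id : op_comp 1%N;
  op_gamma : forall r (n : 'I_r -> nat),
    op_comp r -> (forall i, op_comp (n i)) -> op_comp (\sum_(i < r) n i)%N;
  op_gamma_linl : forall r (n : 'I_r -> nat) (g : forall i, op_comp (n i)),
    linear (fun f : op_comp r => op_gamma f g);
  op_gamma_linr : forall r (n : 'I_r -> nat) (f : op_comp r)
      (g : forall i, op_comp (n i)) (i : 'I_r),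
    linear (fun x : op_comp (n i) => op_gamma f (dfwith g i x));
  op_gamma_idl : forall n (f : op_comp n),
    same_op (O := op_comp)
      (op_gamma (n := fun=> n) op_id (fun _ : 'I_1 => f)) f;
  op_gamma_idr : forall r (f : op_comp r),
    same_op (O := op_comp) (op_gamma f (fun _ : 'I_r => op_id)) f;
  op_gamma_assoc : forall r (n : 'I_r -> nat) (m : forall i, 'I_(n i) -> nat)
      (f : op_comp r) (g : forall i, op_comp (n i))
      (h : forall i (j : 'I_(n i)), op_comp (m i j)),
    same_op (O := op_comp)
      (op_gamma (op_gamma f g)
         (fun s => h (tagnat.sig1 s) (tagnat.sig2 s)))
      (op_gamma f (fun i => op_gamma (g i) (h i)))
}.

Arguments op_id {k} o.
Arguments op_gamma {k} o {r n} f g.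

Definition op_cast (O : nat -> Type) m n (e : m = n) (x : O m) : O n :=
  eq_rect m O x n e.

Lemma op_castP (O : nat -> Type) m n (e : m = n) (x : O m) :
  same_op (op_cast e x) x.
Proof. by case: n / e. Qed.

Lemma sum_insert p q (j : 'I_p) :
  (\sum_(i < p) (if i == j then q else 1) = (p + q).-1)%N.
Proof.
rewrite (bigD1 j) //= eqxx (eq_bigr (fun=> 1%N)); last by move=> i /negbTE ->.
rewrite sum1_card cardC1 card_ord addnC.
by case: p j => [[]|p _] //=; rewrite addSn.
Qed.

Section PartialComposition.
Variables (k : fieldType) (O : operad k).

Definition op_insert p q (j : 'I_p) (g : O q) (i : 'I_p) :
    O (if i == j then q else 1%N) :=
  if i == j as b return O (if b then q else 1%N) then g else op_id O.

(* [f \circ_j g], the inputs being numbered from [0]. *)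
Definition op_pcomp p q (f : O p) (j : 'I_p) (g : O q) : O (p + q).-1 :=
  op_cast (O := op_comp O) (sum_insert q j) (op_gamma O f (op_insert j g)).

Definition op_circ2 (m : O 2%N) : O 3%N := op_pcomp m ord0 m - op_pcomp m ord_max m.

End PartialComposition.

Record mult_operad (k : fieldType) := MultOperad {
  mo_operad :> operad k;
  mo_mul : mo_operad 2%N;
  mo_mulP : op_circ2 mo_mul = 0
}.

Section Morphisms.
Variable k : fieldType.

Definition is_operad_morphism (O O' : operad k) (F : forall n, O n -> O' n) :=
  [/\ forall n, linear (F n),
      F 1%N (op_id O) = op_id O' &
      forall r (n : 'I_r -> nat) (f : O r) (g : forall i, O (n i)),
        F _ (op_gamma O f g) = op_gamma O' (F r f) (fun i => F _ (g i))].

Definition is_operad_iso (O O' : operad k) (F : forall n, O n -> O' n) :=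
  is_operad_morphism F /\
  exists G : forall n, O' n -> O n,
    [/\ is_operad_morphism G, forall n, cancel (F n) (G n)
      & forall n, cancel (G n) (F n)].

Definition is_mult_operad_iso (O O' : mult_operad k)
    (F : forall n, O n -> O' n) :=
  is_operad_iso F /\ F 2%N (mo_mul O) = mo_mul O'.

End Morphisms.

(* [n_0 + ... + n_(i-1)] *)
Definition offset r (n : 'I_r -> nat) (i : nat) : nat :=
  (\sum_(j < r | j < i) n j)%N.

Section Offset.
Variables (r : nat) (n : 'I_r -> nat).

Lemma offset0 : offset n 0 = 0%N.
Proof. by rewrite /offset big_pred0. Qed.

Lemma offset_ge i : (r <= i)%N -> offset n i = (\sum_(j < r) n j)%N.
Proof.
by move=> ri; apply: eq_bigl => j; rewrite (leq_trans (ltn_ord j) ri).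
Qed.

Lemma offsetS (i : 'I_r) : offset n i.+1 = (offset n i + n i)%N.
Proof.
rewrite /offset (bigD1 i) //= addnC; congr (_ + _)%N.
by apply: eq_bigl => j; rewrite ltnS ltn_neqAle andbC.
Qed.

Lemma offset_mono i j : (i <= j)%N -> (offset n i <= offset n j)%N.
Proof.
move=> ij; rewrite /offset big_mkcond [leqRHS]big_mkcond /=.
by apply: leq_sum => l _; case: ltnP => // li; rewrite (leq_trans li ij).
Qed.

Lemma offset_le i : (offset n i <= \sum_(j < r) n j)%N.
Proof.
rewrite -(offset_ge (leqnn r)); case: (leqP i r) => [|/ltnW] ir.
  exact: offset_mono.
by rewrite offset_ge // offset_ge.
Qed.

Lemma offsetD_le (i : 'I_r) q : (q <= n i)%N ->
  (offset n i + q <= \sum_(j < r) n j)%N.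
Proof.
by move=> qn; apply: leq_trans (offset_le i.+1); rewrite offsetS leq_add2l.
Qed.

Lemma RankE (i : 'I_r) (q : 'I_(n i)) :
  tagnat.Rank i q = (offset n i + q)%N :> nat.
Proof. exact: tagnat.RankEsum. Qed.

End Offset.

Lemma offset1 r (i : nat) : (i <= r)%N -> offset (fun _ : 'I_r => 1%N) i = i.
Proof.
elim: i => [|i IH] ir; first exact: offset0.
by rewrite (offsetS _ (Ordinal ir)) /= IH ?addn1 // ltnW.
Qed.

Section OffsetOffset.
Variables (r : nat) (n : 'I_r -> nat) (m : forall i, 'I_(n i) -> nat).
Let m' (s : 'I_(\sum_(i < r) n i)) := m (tagnat.sig2 s).
Let M (i : 'I_r) := (\sum_(j < n i) m j)%N.

Lemma m'_rank p : m' (tagnat.rank p) = m (tagged p).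
Proof. by rewrite /m' /tagnat.sig2 /tagnat.sig1 tagnat.rankK. Qed.

Lemma sum_sum : (\sum_s m' s = \sum_i M i)%N.
Proof.
rewrite sig_big_dep /= (reindex _ tagnat.sig_bij_on) /=.
by apply: eq_bigr.
Qed.

Lemma offset_offsetD (i : 'I_r) q : (q <= n i)%N ->
  offset m' (offset n i + q)%N = (offset M i + offset (@m i) q)%N.
Proof.
move=> qn; rewrite /offset -/(offset n i).
rewrite (reindex (@tagnat.rank _ n) (onW_bij _ (@tagnat.rank_bij _ n))) /=.
transitivity (\sum_(p : {i & 'I_(n i)}
    | (offset n (tag p) + tagged p < offset n i + q)%N) m (tagged p))%N.
  apply: eq_big => [p|p _]; last exact: m'_rank.
  by congr (_ < _)%N; exact: (tagnat.rankEsum p).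
rewrite -(sig_big_dep xpredT
  (fun i' (j' : 'I_(n i')) => offset n i' + j' < offset n i + q)%N
  (fun i' j' => m j')) /=.
rewrite (bigID (fun i' : 'I_r => (i' < i)%N)) /=; congr (_ + _)%N.
  apply: eq_bigr => i' i'i; apply: eq_bigl => j.
  apply/idP; apply: (leq_trans _ (leq_addr _ _)).
  by apply: leq_trans (offset_mono _ i'i); rewrite offsetS ltn_add2l.
rewrite (bigD1 i) ?ltnn //= [X in (_ + X)%N]big1 ?addn0 => [|i' /andP[]].
  by apply: eq_bigl => j; rewrite ltn_add2l.
rewrite -leqNgt leq_eqVlt => /orP[/eqP/val_inj->|ii' _]; first by rewrite eqxx.
rewrite big_pred0 // => j; apply/negbTE; rewrite -leqNgt.
apply: leq_trans (leq_addr _ _); apply: leq_trans (offset_mono _ ii').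
by rewrite offsetS leq_add2l.
Qed.

Lemma offset_offset i : (i <= r)%N -> offset m' (offset n i) = offset M i.
Proof.
rewrite leq_eqVlt => /orP[/eqP->|ir].
  by rewrite !offset_ge // sum_sum.
by rewrite -[offset n i]addn0 (@offset_offsetD (Ordinal ir) 0) // offset0 addn0.
Qed.

End OffsetOffset.

Record simplex d (P : porderType d) (n : nat) := Simplex {
  vertex :> 'I_n.+1 -> P;
  vertex_mono : forall i j : 'I_n.+1, (i <= j)%N -> (vertex i <= vertex j)%O
}.

Lemma simplexP d (P : porderType d) n (v w : simplex P n) : v =1 w -> v = w.
Proof.
case: v w => v vP [w wP] /= /funext vw; case: w / vw in wP *.
by congr Simplex; exact: Prop_irrelevance.
Qed.

Section Faces.
Context d (P : porderType d).

Lemma outer_vertex_subproof r (n : 'I_r -> nat) (i : 'I_r.+1) :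
  (offset n i < (\sum_(j < r) n j).+1)%N.
Proof. exact: offset_le. Qed.

Lemma block_vertex_subproof r (n : 'I_r -> nat) (i : 'I_r) (q : 'I_(n i).+1) :
  (offset n i + q < (\sum_(j < r) n j).+1)%N.
Proof. by apply: offsetD_le; rewrite -ltnS. Qed.

Lemma outer_face_subproof r (n : 'I_r -> nat)
    (v : simplex P (\sum_(i < r) n i)) (i j : 'I_r.+1) : (i <= j)%N ->
  (v (Ordinal (outer_vertex_subproof n i))
     <= v (Ordinal (outer_vertex_subproof n j)))%O.
Proof. by move=> ij; apply: vertex_mono; exact: offset_mono. Qed.

Lemma block_face_subproof r (n : 'I_r -> nat)
    (v : simplex P (\sum_(i < r) n i)) (i : 'I_r) (p q : 'I_(n i).+1) :
  (p <= q)%N ->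
  (v (Ordinal (block_vertex_subproof p))
     <= v (Ordinal (block_vertex_subproof q)))%O.
Proof. by move=> pq; apply: vertex_mono; rewrite leq_add2l. Qed.

(* the vertices [0, n_0, n_0 + n_1, ...] of [v] *)
Definition outer_face r (n : 'I_r -> nat) (v : simplex P (\sum_(i < r) n i)) :
    simplex P r :=
  Simplex (outer_face_subproof v).

(* the consecutive vertices of [v] from [offset n i] to [offset n i.+1] *)
Definition block_face r (n : 'I_r -> nat) (v : simplex P (\sum_(i < r) n i))
    (i : 'I_r) : simplex P (n i) :=
  Simplex (block_face_subproof v (i := i)).

Lemma outer_faceE r (n : 'I_r -> nat) (v : simplex P (\sum_(i < r) n i))
    (i : 'I_r.+1) (l : 'I_(\sum_(i < r) n i).+1) :
  l = offset n i :> nat -> outer_face v i = v l.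
Proof. by move=> e /=; congr (v _); exact: val_inj. Qed.

Lemma block_faceE r (n : 'I_r -> nat) (v : simplex P (\sum_(i < r) n i))
    (i : 'I_r) (q : 'I_(n i).+1) (l : 'I_(\sum_(i < r) n i).+1) :
  l = (offset n i + q)%N :> nat -> block_face v i q = v l.
Proof. by move=> e /=; congr (v _); exact: val_inj. Qed.

End Faces.

Section SimplicialOperad.
Variables (k : fieldType) (d : Order.disp_t) (P : porderType d).

Definition cochain (n : nat) : lmodType k := simplex P n -> k^o.

Definition cochain_id : cochain 1%N := fun=> 1.

Definition cochain_gamma r (n : 'I_r -> nat) (f : cochain r)
    (g : forall i, cochain (n i)) : cochain (\sum_(i < r) n i)%N :=
  fun v => f (outer_face v) * \prod_(i < r) g i (block_face v i).

Definition same_simplex m n (v : simplex P m) (w : simplex P n) :=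
  forall (i : 'I_m.+1) (j : 'I_n.+1), i = j :> nat -> v i = w j.

Lemma same_simplex_eq n (v w : simplex P n) : same_simplex v w -> v = w.
Proof. by move=> vw; apply: simplexP => i; exact: vw. Qed.

Lemma same_cochain m n (x : cochain m) (y : cochain n) : m = n ->
  (forall v w, same_simplex v w -> x v = y w) -> same_op (O := cochain) x y.
Proof.
move=> e; case: n / e y => y xy; congr existT; apply: funext => v.
by apply: xy => i j /val_inj ->.
Qed.

Lemma cochain_gamma_linl r (n : 'I_r -> nat) (g : forall i, cochain (n i)) :
  linear (fun f : cochain r => cochain_gamma f g).
Proof.
by move=> c f f'; apply: funext => v; rewrite /cochain_gamma mulrDl -scalerAl.
Qed.

Lemma cochain_gamma_linr r (n : 'I_r -> nat) (f : cochain r)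
    (g : forall i, cochain (n i)) (i : 'I_r) :
  linear (fun x : cochain (n i) => cochain_gamma f (dfwith g i x)).
Proof.
move=> c x y; apply: funext => v.
have E z : cochain_gamma f (dfwith g i z) v = f (outer_face v) *
    (z (block_face v i) * \prod_(j < r | j != i) g j (block_face v j)).
  rewrite /cochain_gamma (bigD1 i) //= dfwithin; congr (_ * (_ * _)).
  by apply: eq_bigr => j ji; rewrite dfwithout // eq_sym.
rewrite [RHS]/= E [X in _ = X + _]/(GRing.scale _ _) /= !E.
by rewrite mulrDl mulrDr -scalerAl -scalerAr.
Qed.

Lemma cochain_gamma_idl n (f : cochain n) :
  same_op (O := cochain)
    (cochain_gamma (n := fun=> n) cochain_id (fun _ : 'I_1 => f)) f.
Proof.
apply: same_cochain => [|v w vw]; first by rewrite big_ord1.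
rewrite /cochain_gamma mul1r big_ord1; congr f; apply: same_simplex_eq.
by move=> i j /= ij; apply: vw => /=; rewrite offset0 add0n.
Qed.

Lemma cochain_gamma_idr r (f : cochain r) :
  same_op (O := cochain) (cochain_gamma f (fun _ : 'I_r => cochain_id)) f.
Proof.
apply: same_cochain => [|v w vw]; first by rewrite sum1_card card_ord.
rewrite /cochain_gamma big1 // mulr1; congr f; apply: same_simplex_eq.
by move=> i j /= ij; apply: vw => /=; rewrite offset1 // -ltnS.
Qed.

Lemma cochain_gamma_assoc r (n : 'I_r -> nat) (m : forall i, 'I_(n i) -> nat)
    (f : cochain r) (g : forall i, cochain (n i))
    (h : forall i (j : 'I_(n i)), cochain (m i j)) :
  same_op (O := cochain)
    (cochain_gamma (cochain_gamma f g)
       (fun s => h (tagnat.sig1 s) (tagnat.sig2 s)))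
    (cochain_gamma f (fun i => cochain_gamma (g i) (h i))).
Proof.
apply: same_cochain => [|v w vw]; first exact: sum_sum.
rewrite /cochain_gamma big_split mulrA; congr (_ * _ * _).
- congr f; apply: same_simplex_eq => i j ij /=; apply: vw => /=.
  by rewrite ij offset_offset // -ltnS.
- apply: eq_bigr => i _; congr (g i); apply: same_simplex_eq => p q pq /=.
  by apply: vw => /=; rewrite pq offset_offsetD // -ltnS.
rewrite sig_big_dep /= (reindex _ tagnat.sig_bij_on) /=.
apply: eq_bigr => s _; congr (h _ _); apply: same_simplex_eq => p q pq.
apply: vw => /=; rewrite pq addnA; congr (_ + _)%N.
rewrite {1}(tagnat.rect s) -/(offset n _) offset_offsetD //.
exact: ltnW.
Qed.

Definition simplicial_operad : operad k :=
  Operad cochain_gamma_linl cochain_gamma_linr cochain_gamma_idl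
    cochain_gamma_idr cochain_gamma_assoc.

Definition cochain_mul : cochain 2%N := fun=> 1.

Lemma cochain_cast m n (e : m = n) (x : cochain m) v :
  exists2 w, same_simplex w v & op_cast (O := cochain) e x v = x w.
Proof. by case: n / e v => v; exists v => // i j /val_inj ->. Qed.

Lemma cochain_mulP : op_circ2 (O := simplicial_operad) cochain_mul = 0.
Proof.
have one (j : 'I_2) v :
    op_pcomp (O := simplicial_operad) cochain_mul j cochain_mul v = 1.
  pose x := op_gamma simplicial_operad cochain_mul
    (op_insert (O := simplicial_operad) j cochain_mul).
  case: (cochain_cast (sum_insert 2 j) x v) => w _ e; rewrite [LHS]e.
  rewrite /x /= /cochain_gamma mul1r big1 // => i _.
  by move: (block_face w i); rewrite /op_insert; case: (i == j).
apply/eqP; rewrite /op_circ2 subr_eq0; apply/eqP/funext => v.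
by rewrite !one.
Qed.

Definition simplicial_mult_operad : mult_operad k := MultOperad cochain_mulP.

End SimplicialOperad.

(* Associative unital [k]-algebras. MathComp's [algType k] requires [1 != 0],
   which fails for the incidence algebra of the empty poset. *)
Record assoc_alg (k : fieldType) := AssocAlg {
  alg_space :> lmodType k;
  amul : alg_space -> alg_space -> alg_space;
  aone : alg_space;
  amulA : associative amul;
  amul1l : left_id aone amul;
  amul1r : right_id aone amul;
  amul_linl : forall y, linear (fun x => amul x y);
  amul_linr : forall x, linear (amul x)
}.

Notation "x ** y" := (amul x y) (at level 40, left associativity) : ring_scope.

Section AlgebraTheory.
Variables (k : fieldType) (A : assoc_alg k).
Implicit Types x y z : A.

Lemma amul0l y : (0 : A) ** y = 0.
Proof.
have := amul_linl y (-1) 0 0.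
by rewrite scaler0 add0r scaleN1r addNr.
Qed.

Lemma amul0r x : x ** (0 : A) = 0.
Proof.
have := amul_linr x (-1) 0 0.
by rewrite scaler0 add0r scaleN1r addNr.
Qed.

End AlgebraTheory.

Definition upd n (T : Type) (a : 'I_n -> T) (i : 'I_n) (x : T) : 'I_n -> T :=
  fun j => if j == i then x else a j.

(* An [n]-ary multilinear map is a function of [a : 'I_n -> A]; an element of
   [A] is identified with the corresponding [0]-ary map, so that [rel_center]
   is the condition defining [C^0(A, S; A)]. [S] is meant to be a subalgebra,
   but only its elements matter here. *)
Record rel_cochain (k : fieldType) (A : assoc_alg k) (S : set A) (n : nat)
    (f : ('I_n -> A) -> A) : Prop := RelCochain {
  rel_linear : forall a (i : 'I_n), linear (fun x : A => f (upd a i x));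
  rel_left : forall a (b : A) (i : 'I_n), S b -> i = 0%N :> nat ->
    f (upd a i (b ** a i)) = b ** f a;
  rel_mid : forall a (b : A) (i j : 'I_n), S b -> j = i.+1 :> nat ->
    f (upd a i (a i ** b)) = f (upd a j (b ** a j));
  rel_right : forall a (b : A) (i : 'I_n), S b -> i.+1 = n ->
    f (upd a i (a i ** b)) = f a ** b;
  rel_center : n = 0%N -> forall a (b : A), S b -> f a ** b = b ** f a
}.

Section Update.
Variables (T : Type) (n : nat).
Implicit Types a : 'I_n -> T.

Lemma upd_same a i x : upd a i x i = x.
Proof. by rewrite /upd eqxx. Qed.

Lemma upd_other a i x j : j != i -> upd a i x j = a j.
Proof. by rewrite /upd => /negbTE ->. Qed.

Lemma upd_upd a i x y : upd (upd a i x) i y = upd a i y.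
Proof. by apply: funext => j; rewrite /upd; case: eqP. Qed.

End Update.

Section Gaps.
Variables (k : fieldType) (A : assoc_alg k) (S : set A).

(* Inserting [b] in the gap in front of the [p]-th argument, from either side:
   the conditions defining [rel_cochain] say that both results agree. *)
Definition gap_l n (f : ('I_n -> A) -> A) a (p : nat) (b : A) : A :=
  if insub p is Some i then f (upd a i (b ** a i)) else f a ** b.

Definition gap_r n (f : ('I_n -> A) -> A) a (p : nat) (b : A) : A :=
  if p isn't p'.+1 then b ** f a else
  if insub p' is Some i then f (upd a i (a i ** b)) else 0.

Lemma gap_lE n (f : ('I_n -> A) -> A) a (i : 'I_n) b :
  gap_l f a i b = f (upd a i (b ** a i)).
Proof. by rewrite /gap_l valK. Qed.

Lemma gap_l_last n (f : ('I_n -> A) -> A) a b : gap_l f a n b = f a ** b.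
Proof. by rewrite /gap_l insubF // ltnn. Qed.

Lemma gap_rE n (f : ('I_n -> A) -> A) a (i : 'I_n) b :
  gap_r f a i.+1 b = f (upd a i (a i ** b)).
Proof. by rewrite /gap_r valK. Qed.

Lemma rel_gap n (f : ('I_n -> A) -> A) a p b : rel_cochain S f -> S b ->
  (p <= n)%N -> gap_l f a p b = gap_r f a p b.
Proof.
move=> fP Sb; rewrite leq_eqVlt => /orP[/eqP->|pn].
  rewrite gap_l_last; case: n f a fP => [|n] f a fP; first exact: (rel_center fP).
  by rewrite -[n.+1]/(ord_max : 'I_n.+1).+1 gap_rE (rel_right fP).
rewrite -[p in LHS]/(Ordinal pn : nat) gap_lE; case: p pn => [|p] pn.
  exact: (rel_left fP).
rewrite -[p in RHS]/(Ordinal (ltnW pn) : nat) gap_rE.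
by rewrite (rel_mid fP a (j := Ordinal pn)).
Qed.

Lemma gap_rel n (f : ('I_n -> A) -> A) :
  (forall a i, linear (fun x : A => f (upd a i x))) ->
  (forall a p b, S b -> (p <= n)%N -> gap_l f a p b = gap_r f a p b) ->
  rel_cochain S f.
Proof.
move=> flin fgap; split=> //.
- move=> a b i Sb i0; rewrite -gap_lE fgap ?i0 //.
- move=> a b i j Sb ji; rewrite -gap_lE fgap ?ji ?gap_rE // -ji.
- by move=> a b i Sb iN; rewrite -gap_rE -fgap ?iN ?gap_l_last.
- by case: n f {flin} fgap => // f fgap _ a b Sb; rewrite -gap_l_last fgap.
Qed.

End Gaps.

Section RelativeCochains.
Variables (k : fieldType) (A : assoc_alg k) (S : set A).

Definition hochschild_pred n : {pred ('I_n -> A) -> A} :=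
  [pred f | `[< rel_cochain S f >]].

Lemma hochschild_submod n : submod_closed (@hochschild_pred n).
Proof.
split=> [|c f g /asboolP fP /asboolP gP]; apply/asboolP.
  have E a : (0 : ('I_n -> A) -> A) a = 0 by [].
  by split=> [a i c x y|a b i _ _|a b i j _ _|a b i _ _|_ a b _];
    rewrite ?E ?scaler0 ?addr0 ?amul0l ?amul0r.
have E a : (c *: f + g) a = c *: f a + g a by [].
split=> [a i c' x y|a b i Sb i0|a b i j Sb ij|a b i Sb iN|n0 a b Sb];
  rewrite !E.
- rewrite (rel_linear fP) (rel_linear gP) !scalerDr !scalerA mulrC.
  by rewrite -!addrA; congr (_ + _); rewrite addrCA.
- by rewrite (rel_left fP) // (rel_left gP) // amul_linr.
- by rewrite (rel_mid fP _ (j := j)) // (rel_mid gP _ (j := j)).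
- by rewrite (rel_right fP) // (rel_right gP) // amul_linl.
- by rewrite amul_linl amul_linr (rel_center fP) // (rel_center gP).
Qed.

HB.instance Definition _ n :=
  GRing.isSubmodClosed.Build k (('I_n -> A) -> A) (@hochschild_pred n)
    (@hochschild_submod n).

Record hochschild n := Hochschild {
  hochschild_fun :> ('I_n -> A) -> A;
  _ : hochschild_fun \in @hochschild_pred n
}.

HB.instance Definition _ n := [isSub for @hochschild_fun n].
HB.instance Definition _ n := [Choice of hochschild n by <:].
HB.instance Definition _ n := [SubChoice_isSubLmodule of hochschild n by <:].

Lemma hochschildP n (f : hochschild n) : rel_cochain S f.
Proof. by case: f => f fP; apply/asboolP. Qed.

Definition mk_hochschild n (f : ('I_n -> A) -> A) (fP : rel_cochain S f) :
    hochschild n :=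
  Hochschild (introT (asboolP _) fP).

Lemma hochschild_eq n (f g : hochschild n) : f =1 g -> f = g.
Proof. by move=> fg; apply: val_inj; apply: funext. Qed.

End RelativeCochains.

Section HochschildOperad.
Variables (k : fieldType) (A : assoc_alg k) (S : set A).
Local Notation C := (hochschild S).

Lemma hochschild_id_subproof : rel_cochain S (fun a : 'I_1 -> A => a ord0).
Proof.
by split=> [a i c x y|a b i _ _|a b i j _|a b i _ _|] //; rewrite ?ord1 ?upd_same.
Qed.

Definition hochschild_id : C 1%N := mk_hochschild hochschild_id_subproof.

Definition block_args r (n : 'I_r -> nat) (a : 'I_(\sum_(i < r) n i) -> A)
    (i : 'I_r) : 'I_(n i) -> A :=
  fun q => a (tagnat.Rank i q).

Arguments block_args {r n} a i q.

Lemma block_args_upd r (n : 'I_r -> nat) (a : 'I_(\sum_(i < r) n i) -> A)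
    (i : 'I_r) (q : 'I_(n i)) x :
  block_args (upd a (tagnat.Rank i q) x) i = upd (block_args a i) q x.
Proof.
apply: funext => p; rewrite /block_args /upd.
by rewrite -(inj_eq val_inj) /= tagnat.eq_Rank eqxx.
Qed.

Lemma block_args_upd_neq r (n : 'I_r -> nat) (a : 'I_(\sum_(i < r) n i) -> A)
    (i j : 'I_r) (q : 'I_(n i)) x : j != i ->
  block_args (upd a (tagnat.Rank i q) x) j = block_args a j.
Proof.
move=> ji; apply: funext => p; rewrite /block_args upd_other //.
by rewrite -(inj_eq val_inj) /= tagnat.eq_Rank (negbTE ji).
Qed.

Section Gamma.
Variables (r : nat) (n : 'I_r -> nat) (f : C r) (g : forall i, C (n i)).
Let N := (\sum_(i < r) n i)%N.
Implicit Types a : 'I_N -> A.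

Let X a i := g i (block_args a i).

Definition hochschild_gamma_fun a : A := f (fun i => g i (block_args a i)).

Let F := hochschild_gamma_fun.

Let F_upd a i (q : 'I_(n i)) x :
  F (upd a (tagnat.Rank i q) x) = f (upd (X a) i (g i (upd (block_args a i) q x))).
Proof.
congr (f _); apply: funext => j; rewrite /X.
have [->|ji] := eqVneq j i; first by rewrite upd_same block_args_upd.
by rewrite upd_other // block_args_upd_neq.
Qed.

Let gapM a b t u : S b -> (t <= u <= r)%N -> offset n t = offset n u ->
  gap_l f (X a) t b = gap_l f (X a) u b.
Proof.
move=> Sb /andP[tu ur]; elim: u tu ur => [|u IH].
  by rewrite leqn0 => /eqP ->.
rewrite leq_eqVlt => /orP[/eqP->//|]; rewrite ltnS => tu ur tuo.
have uu : offset n u = offset n u.+1.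
  apply/eqP; rewrite eqn_leq offset_mono //= -tuo; exact: offset_mono.
rewrite IH ?tuo ?uu // 1?ltnW // (rel_gap _ (hochschildP f) Sb ur).
pose i := Ordinal ur; have ni0 : n i = 0%N.
  by move/eqP: uu; rewrite (offsetS n i) -[X in X == _]addn0 eqn_add2l => /eqP.
rewrite -[u in LHS]/(i : nat) -[u in RHS]/(i : nat) gap_lE gap_rE; congr (f _).
by congr upd; rewrite /X (rel_center (hochschildP (g i)) ni0).
Qed.

Let gapM' a b t u : S b -> (t <= r)%N -> (u <= r)%N ->
  offset n t = offset n u -> gap_l f (X a) t b = gap_l f (X a) u b.
Proof.
move=> Sb tr ur tu; case: (leqP t u) => [le|/ltnW le].
  by apply: gapM; rewrite // le ur.
by apply/esym/gapM; rewrite // le tr.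
Qed.

Let T a b i q : A := f (upd (X a) i (gap_l (g i) (block_args a i) q b)).

Let T_first a b (i : 'I_r) : S b -> T a b i 0 = gap_l f (X a) i b.
Proof. by move=> Sb; rewrite /T (rel_gap _ (hochschildP (g i))) // gap_lE. Qed.

Let T_last a b (i : 'I_r) : S b -> T a b i (n i) = gap_l f (X a) i.+1 b.
Proof.
by move=> Sb; rewrite (rel_gap _ (hochschildP f)) // gap_rE /T gap_l_last.
Qed.

Let F_gap_l a b p : S b -> (p <= N)%N ->
  (exists i (q : 'I_(n i)), p = tagnat.Rank i q :> nat /\ gap_l F a p b = T a b i q)
  \/ p = N /\ gap_l F a p b = gap_l f (X a) r b.
Proof.
move=> Sb; rewrite leq_eqVlt => /orP[/eqP->|pN]; [right|left].
  by rewrite !gap_l_last.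
pose s := Ordinal pN; exists (tagnat.sig1 s), (tagnat.sig2 s).
rewrite tagnat.sig2K; split=> //.
rewrite -[p]/(s : nat) gap_lE /T gap_lE.
by rewrite -{1 2}(tagnat.sig2K s) F_upd.
Qed.

Let F_gap_r a b p : S b -> (p <= N)%N ->
  (exists i (q : 'I_(n i)), p = (tagnat.Rank i q).+1 :> nat
    /\ gap_r F a p b = T a b i q.+1)
  \/ p = 0%N /\ gap_r F a p b = gap_l f (X a) 0 b.
Proof.
move=> Sb; case: p => [|p] pN; [right|left].
  by rewrite (rel_gap _ (hochschildP f)).
pose s := Ordinal pN; exists (tagnat.sig1 s), (tagnat.sig2 s).
rewrite tagnat.sig2K; split=> //.
rewrite -[p]/(s : nat) gap_rE /T (rel_gap _ (hochschildP _)) // gap_rE.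
by rewrite -{1 2}(tagnat.sig2K s) F_upd.
Qed.

(* the end of a block is a gap of the outer map unless another argument of the
   block follows *)
Let T_succ a b (i : 'I_r) (q : 'I_(n i)) : S b ->
  (exists2 q' : 'I_(n i), q' = q.+1 :> nat &
     (tagnat.Rank i q').-1 = tagnat.Rank i q)
  \/ (tagnat.Rank i q).+1 = offset n i.+1
     /\ T a b i q.+1 = gap_l f (X a) i.+1 b.
Proof.
move=> Sb; have := ltn_ord q; rewrite leq_eqVlt => /orP[/eqP qn|qn].
  by right; rewrite RankE offsetS -addnS qn T_last.
by left; exists (Ordinal qn); rewrite // !RankE /= addnS.
Qed.

Lemma hochschild_gamma_subproof : rel_cochain S hochschild_gamma_fun.
Proof.
apply: gap_rel => [a s|a p b Sb pN].
  rewrite -(tagnat.sig2K s) => c x y; rewrite -/F !F_upd.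
  by rewrite (rel_linear (hochschildP (g _))) (rel_linear (hochschildP f)).
rewrite -/F; have rl := F_gap_r a Sb pN; case: (F_gap_l a Sb pN) => [[i [q [pE ->]]]|[pE ->]].
  case: rl => [[i' [q' [pE' ->]]]|[p0 ->]].
    case: (T_succ a q' Sb) => [[q'' qE rE]|[rE ->]].
      have : tagnat.Rank i q = tagnat.Rank i' q'' :> nat.
        by rewrite -pE pE' !RankE qE addnS.
      move/eqP; rewrite tagnat.eq_Rank => /andP[/eqP ii' /eqP qq].
      by rewrite -qE qq ii'.
    case: q => q qn in pE *; case: q => [|q] in qn pE *.
      rewrite /= T_first //; apply: gapM' => //; first exact: ltnW.
      by rewrite -rE -pE' pE RankE /= addn0.
    have : tagnat.Rank i (Ordinal (ltnW qn)) = tagnat.Rank i' q' :> nat.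
      by move: pE; rewrite pE' !RankE /= addnS => -[].
    move/eqP; rewrite tagnat.eq_Rank => /andP[/eqP ii' /eqP /= qq].
    by rewrite -T_last //; move: rE; rewrite RankE -addnS offsetS => /addnI <-;
       rewrite /= qq ii'.
  have : (offset n i + q)%N = 0%N by rewrite -RankE -pE.
  move/eqP; rewrite addn_eq0 => /andP[/eqP o0 /eqP ->]; rewrite T_first //.
  by apply: gapM'; rewrite ?offset0 // ltnW.
case: rl => [[i' [q' [pE' ->]]]|[p0 ->]].
  case: (T_succ a q' Sb) => [[q'' qE rE]|[rE ->]].
    have := ltn_ord (tagnat.Rank i' q''); rewrite RankE qE addnS -RankE -pE' pE.
    by rewrite ltnn.
  by apply: gapM' => //; rewrite -rE -pE' pE offset_ge.
by apply: gapM'; rewrite // offset0 offset_ge // -/N -pE.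
Qed.

Definition hochschild_gamma : C N := mk_hochschild hochschild_gamma_subproof.

End Gamma.

Lemma hochschild_gamma_linl r (n : 'I_r -> nat) (g : forall i, C (n i)) :
  linear (fun f : C r => hochschild_gamma f g).
Proof. by move=> c f f'; apply: hochschild_eq => a. Qed.

Lemma hochschild_gamma_linr r (n : 'I_r -> nat) (f : C r)
    (g : forall i, C (n i)) (i : 'I_r) :
  linear (fun x : C (n i) => hochschild_gamma f (dfwith g i x)).
Proof.
move=> c x y; apply: hochschild_eq => a.
have E z : hochschild_gamma f (dfwith g i z) a =
    f (upd (fun j => g j (block_args a j)) i (z (block_args a i))).
  congr (f _); apply: funext => j; rewrite /upd.
  by have [->|ji] := eqVneq j i; rewrite ?dfwithin ?dfwithout // eq_sym.
by rewrite E (rel_linear (hochschildP f)) -!E.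
Qed.

Lemma same_hochschild m n (x : C m) (y : C n) : m = n ->
  (forall (a : 'I_m -> A) (a' : 'I_n -> A),
    (forall (i : 'I_m) (j : 'I_n), i = j :> nat -> a i = a' j) -> x a = y a') ->
  same_op (O := C) x y.
Proof.
move=> e; case: n / e y => y xy; congr existT; apply: hochschild_eq => a.
by apply: xy => i j ij; congr (a _); exact: val_inj.
Qed.

Lemma hochschild_gamma_idl n (f : C n) :
  same_op (O := C)
    (hochschild_gamma (n := fun=> n) hochschild_id (fun _ : 'I_1 => f)) f.
Proof.
apply: same_hochschild => [|a a' aa']; first by rewrite big_ord1.
congr (f _); apply: funext => q; apply: aa'.
by rewrite RankE offset0 add0n.
Qed.

Lemma hochschild_gamma_idr r (f : C r) :
  same_op (O := C) (hochschild_gamma f (fun _ : 'I_r => hochschild_id)) f.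
Proof.
apply: same_hochschild => [|a a' aa']; first by rewrite sum1_card card_ord.
congr (f _); apply: funext => q; apply: aa'.
by rewrite RankE offset1 ?addn0 // ltnW.
Qed.

Lemma hochschild_gamma_assoc r (n : 'I_r -> nat) (m : forall i, 'I_(n i) -> nat)
    (f : C r) (g : forall i, C (n i))
    (h : forall i (j : 'I_(n i)), C (m i j)) :
  same_op (O := C)
    (hochschild_gamma (hochschild_gamma f g)
       (fun s => h (tagnat.sig1 s) (tagnat.sig2 s)))
    (hochschild_gamma f (fun i => hochschild_gamma (g i) (h i))).
Proof.
apply: same_hochschild => [|a a' aa']; first exact: sum_sum.
congr (f _); apply: funext => i; congr (g i _); apply: funext => q.
have hE (s : 'I_(\sum_(i < r) n i)) (p : {i & 'I_(n i)}) c c' :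
    tagnat.sig s = p ->
    (forall (l : 'I_(m _ (tagnat.sig2 s))) (l' : 'I_(m _ (tagged p))),
       l = l' :> nat -> c l = c' l') ->
    h _ (tagnat.sig2 s) c = h _ (tagged p) c'.
  move=> sp; case: p / sp c' => c' cc'; congr (h _ _ _).
  by apply: funext => l; exact: cc'.
apply: (hE _ (Tagged _ q)) => [|l l' ll']; first exact: tagnat.rankK.
apply: aa'; rewrite !RankE ll' offset_offsetD ?addnA //; exact: ltnW.
Qed.

Definition hochschild_operad : operad k :=
  Operad hochschild_gamma_linl hochschild_gamma_linr hochschild_gamma_idl
    hochschild_gamma_idr hochschild_gamma_assoc.

Lemma hochschild_mul_subproof :
  rel_cochain S (fun a : 'I_2 -> A => a ord0 ** a ord_max).
Proof.
have two (i : 'I_2) : i = ord0 \/ i = ord_max.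
  by case: i => [[|[|//]] i2]; [left|right]; apply: val_inj.
split=> // [a i c x y|a b i _ i0|a b i j _ ji|a b i _ i1].
- by case: (two i) => ->; rewrite /upd /= ?(amul_linl, amul_linr).
- have -> : i = ord0 by apply: val_inj.
  by rewrite /upd /= amulA.
- case: (two i) (two j) ji => -> [] -> // _.
  by rewrite /upd /= amulA.
- have -> : i = ord_max by apply: val_inj; case: i1.
  by rewrite /upd /= amulA.
Qed.

Definition hochschild_mul : C 2%N := mk_hochschild hochschild_mul_subproof.

Lemma hochschild_cast m n (e : m = n) (x : C m) a :
  op_cast (O := C) e x a = x (fun i => a (cast_ord e i)).
Proof.
by case: n / e a => a /=; congr (x _); apply: funext => i; rewrite cast_ord_id.
Qed.

Lemma hochschild_mulP : op_circ2 (O := hochschild_operad) hochschild_mul = 0.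
Proof.
apply/eqP; rewrite /op_circ2 subr_eq0; apply/eqP/hochschild_eq => a.
rewrite /op_pcomp !hochschild_cast /= /hochschild_gamma_fun /=.
have aE (i j : 'I_3) : i = j :> nat -> a i = a j.
  by move=> ij; congr (a _); exact: val_inj.
rewrite /block_args /op_insert /= -amulA.
have offE (n : 'I_2 -> nat) l : offset n l =
    ((if 0 < l then n ord0 else 0) + (if 1 < l then n ord_max else 0))%N.
  rewrite /offset big_mkcond !big_ord_recl big_ord0 /= addn0.
  by congr (_ + _)%N; case: ifP => // _; congr n; exact: val_inj.
by congr (_ ** (_ ** _)); apply: aE; rewrite [LHS]RankE [RHS]RankE !offE.
Qed.

Definition hochschild_mult_operad : mult_operad k := MultOperad hochschild_mulP.

End HochschildOperad.

Definition locally_finite d (P : porderType d) : Prop :=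
  forall x y : P, finite_set [set z : P | (x <= z <= y)%O].

Section IncidenceAlgebra.
Variables (k : fieldType) (d : Order.disp_t) (P : porderType d).

(* The formal sums $\sum_{i \le j} r_{ij} E^{ij}$, possibly infinite, as the
   families $(r_{ij})_{i \le j}$. *)
Definition incidence : lmodType k := {p : P * P | (p.1 <= p.2)%O} -> k^o.

(* the coefficient of $E^{ij}$, extended by 0 when $i \not\le j$ *)
Definition coef (a : incidence) (i j : P) : k :=
  if insub (i, j) is Some p then a p else 0.

(* the morphism $E^{ij}$ if $i \le j$, and 0 otherwise *)
Definition Emor (i j : P) : incidence := fun p => (val p == (i, j))%:R.

(* the formal sum $\sum_i f(i) E^{ii}$ *)
Definition diag_sum (f : P -> k) : incidence :=
  fun p => if (val p).1 == (val p).2 then f (val p).1 else 0.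

Definition incidence_one : incidence := diag_sum (fun=> 1).

Definition incidence_mul (a b : incidence) : incidence :=
  fun p => \sum_(z \in [set z : P | ((val p).1 <= z <= (val p).2)%O])
             (coef a (val p).1 z * coef b z (val p).2).

Lemma coef_out a i j : ~~ (i <= j)%O -> coef a i j = 0.
Proof. by move=> ij; rewrite /coef insubF //; exact: negbTE. Qed.

Lemma coef_val (a : incidence) p : coef a (val p).1 (val p).2 = a p.
Proof. by rewrite /coef -surjective_pairing valK. Qed.

Lemma coef_ext (a b : incidence) :
  (forall i j, (i <= j)%O -> coef a i j = coef b i j) -> a = b.
Proof.
move=> ab; apply: funext => p; rewrite -!coef_val; apply: ab.
exact: (valP p).
Qed.

Lemma coef_fun (F : P -> P -> k) i j :
  coef (fun p => F (val p).1 (val p).2) i j = if (i <= j)%O then F i j else 0.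
Proof.
rewrite /coef; case: insubP => [p ij e|/= /negbTE -> //].
by move: ij; rewrite e /= => ->.
Qed.

Lemma coef_lin c (a b : incidence) i j :
  coef (c *: a + b) i j = c * coef a i j + coef b i j.
Proof.
by rewrite /coef; case: insub => [p|] //=; rewrite mulr0 addr0.
Qed.

Lemma coef_diag f i j : coef (diag_sum f) i j = if i == j then f i else 0.
Proof.
rewrite (coef_fun (fun i j => if i == j then f i else 0)).
by case: eqP => [->|]; rewrite ?lexx // if_same.
Qed.

Lemma coef_Emor i j x y :
  coef (Emor i j) x y = ((x <= y)%O && ((x, y) == (i, j)))%:R.
Proof.
rewrite /coef; case: insubP => [p xy e|/= /negbTE -> //].
by move: xy; rewrite /Emor e /= => ->.
Qed.

Hypothesis lf : locally_finite P.

Let itv (x y : P) : seq P :=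
  finmap.enum_fset (fset_set [set z : P | (x <= z <= y)%O]).

Let mem_itv x y z : (z \in itv x y) = (x <= z <= y)%O.
Proof. by rewrite in_fset_set //; apply/idP/idP; rewrite inE. Qed.

Lemma coef_mul a b x y u w : (x <= u)%O -> (w <= y)%O ->
  coef (incidence_mul a b) u w =
    \sum_(z <- itv x y) coef a u z * coef b z w.
Proof.
move=> xu wy; have F0 z : ~~ (u <= z <= w)%O -> coef a u z * coef b z w = 0.
  by rewrite negb_and => /orP[] /coef_out ->; rewrite ?mul0r ?mulr0.
rewrite (coef_fun (fun u w => \sum_(z \in [set z : P | (u <= z <= w)%O])
  (coef a u z * coef b z w))); case: ifPn => uw; last first.
  rewrite big1_seq // => z _; apply: F0; apply: contra uw => /andP[].
  exact: le_trans.
rewrite fsbig_finite // [RHS](bigID (fun z => (u <= z <= w)%O)) /=.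
rewrite [X in _ = _ + X]big1 ?addr0 // -[RHS]big_filter; apply: perm_big.
apply: uniq_perm; rewrite ?filter_uniq ?finmap.fset_uniq // => z.
rewrite mem_filter !mem_itv; apply/idP/idP => [/[dup] /andP[uz zw] ->|/andP[] //].
by rewrite (le_trans xu uz) (le_trans zw wy).
Qed.

Lemma incidence_mulA : associative incidence_mul.
Proof.
move=> a b c; apply: coef_ext => i j ij.
rewrite (coef_mul a _ (lexx i) (lexx j)) (coef_mul _ c (lexx i) (lexx j)).
transitivity (\sum_(z <- itv i j) \sum_(w <- itv i j)
    coef a i z * coef b z w * coef c w j).
  apply: eq_big_seq => z; rewrite mem_itv => /andP[iz zj].
  rewrite (coef_mul b c iz (lexx j)) big_distrr /=.
  by apply: eq_bigr => w _; rewrite mulrA.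
rewrite exchange_big /=; apply: eq_big_seq => w; rewrite mem_itv => /andP[iw wj].
by rewrite (coef_mul a b (lexx i) wj) big_distrl.
Qed.

Lemma incidence_mul1l : left_id incidence_one incidence_mul.
Proof.
move=> a; apply: coef_ext => i j ij.
rewrite (coef_mul _ a (lexx i) (lexx j)) (bigD1_seq i) ?finmap.fset_uniq //=; last first.
  by rewrite mem_itv lexx.
rewrite coef_diag eqxx mul1r big1 ?addr0 // => z zi.
by rewrite coef_diag eq_sym (negbTE zi) mul0r.
Qed.

Lemma incidence_mul1r : right_id incidence_one incidence_mul.
Proof.
move=> a; apply: coef_ext => i j ij.
rewrite (coef_mul a _ (lexx i) (lexx j)) (bigD1_seq j) ?finmap.fset_uniq //=; last first.
  by rewrite mem_itv lexx ij.
rewrite coef_diag eqxx mulr1 big1 ?addr0 // => z zj.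
by rewrite coef_diag (negbTE zj) mulr0.
Qed.

Lemma incidence_mul_linl b : linear (incidence_mul^~ b).
Proof.
move=> c x y; apply: coef_ext => i j ij; rewrite coef_lin.
rewrite !(coef_mul _ b (lexx i) (lexx j)) big_distrr -big_split /=.
by apply: eq_bigr => z _; rewrite coef_lin mulrDl mulrA.
Qed.

Lemma incidence_mul_linr a : linear (incidence_mul a).
Proof.
move=> c x y; apply: coef_ext => i j ij; rewrite coef_lin.
rewrite !(coef_mul a _ (lexx i) (lexx j)) big_distrr -big_split /=.
by apply: eq_bigr => z _; rewrite coef_lin mulrDr mulrCA.
Qed.

Definition incidence_alg : assoc_alg k :=
  AssocAlg incidence_mulA incidence_mul1l incidence_mul1r
    incidence_mul_linl incidence_mul_linr.

End IncidenceAlgebra.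

Arguments Emor k {d P} i j.

Definition is_subalg (k : fieldType) (A : assoc_alg k) (B : set A) : Prop :=
  [/\ B (aone A), forall (c : k) x y, B x -> B y -> B (c *: x + y)
    & forall x y, B x -> B y -> B (x ** y)].

Section IdentitySubalgebra.
Variables (k : fieldType) (d : Order.disp_t) (P : porderType d).
Variable lf : locally_finite P.
Local Notation kP := (incidence_alg k lf).

(* Closure under formal sums: [B] is closed for coefficientwise convergence,
   [k] being discrete. *)
Definition coef_closed (B : set kP) : Prop :=
  forall x : kP,
    (forall s : seq (P * P), exists2 y : kP, B y &
       forall p, p \in s -> coef y p.1 p.2 = coef x p.1 p.2) ->
    B x.

(* Since the elements of $kP$ are formal sums, generation is understood to
   allow formal sums as well: by [identity_subalgP] the elements of $S$ are the
   $\sum_i r_i E^{ii}$. With finite sums only, $S$ would be too small for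
   relative cochains to be determined by their values on morphisms when, e.g.,
   $P = \mathbb{Z}$. *)
Definition identity_subalg : set kP :=
  smallest [set B | is_subalg B /\ coef_closed B] (range (fun i : P => Emor k i i)).

Lemma identity_subalg_is_subalg : is_subalg identity_subalg.
Proof.
split=> [B [[[]]] //|c x y xS yS B BP|x y xS yS B BP].
  by case: (BP) => -[[_ lB _] _] _; apply: lB; [exact: xS|exact: yS].
by case: (BP) => -[[_ _ mB] _] _; apply: mB; [exact: xS|exact: yS].
Qed.

Lemma identity_subalgP (x : kP) :
  identity_subalg x <-> exists f : P -> k, x = diag_sum f.
Proof.
have diagP (y : kP) : (forall i j, i != j -> coef y i j = 0) <->
    exists f : P -> k, y = diag_sum f.
  split=> [y0|[f ->] i j /negbTE ij]; last by rewrite coef_diag ij.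
  exists (fun i => coef y i i); apply: coef_ext => i j _; rewrite coef_diag.
  by have [->//|/y0] := eqVneq i j.
rewrite -diagP; split.
  move: x; apply: smallest_sub => [|_ [l _ <-] i j ij]; last first.
    rewrite coef_Emor; case: eqP => [[il jl]|]; rewrite ?andbF //.
    by rewrite il jl eqxx in ij.
  split; first split.
  - by move=> i j /negbTE ij; rewrite coef_diag ij.
  - by move=> c y z y0 z0 i j ij; rewrite coef_lin y0 // z0 // mulr0 addr0.
  - move=> y z y0 z0 i j ij; rewrite (coef_mul lf y z (lexx i) (lexx j)).
    rewrite big1 // => l _; have [<-|/y0 ->] := eqVneq i l; last by rewrite mul0r.
    by rewrite z0 // mulr0.
  - move=> y yB i j ij; have [z z0 /(_ (i, j))] := yB [:: (i, j)].
    by rewrite inE eqxx => <- //=; rewrite z0.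
move=> x0 B [[[B1 Blin Bmul] Bcl] BE]; apply: Bcl => s.
exists (\sum_(i <- undup (unzip1 s)) coef x i i *: Emor k i i).
  have B0 : B 0 by have := Blin (-1) _ _ B1 B1; rewrite scaleN1r addNr.
  elim/big_ind: _ => // [y z yB zB|i _].
    by rewrite -[y]scale1r; exact: Blin.
  by rewrite -[X in B X]addr0; apply: Blin => //; apply: BE; exists i.
have coef_sum r i j : coef (\sum_(l <- r) coef x l l *: Emor k l l) i j =
    \sum_(l <- r) coef x l l * coef (Emor k l l) i j.
  elim: r => [|l r IH]; last by rewrite !big_cons coef_lin IH.
  by rewrite !big_nil /coef; case: insub.
move=> [i j] ij_s; rewrite coef_sum /=.
have [ji|ij] := eqVneq i j; last first.
  rewrite x0 // big1 // => l _; rewrite coef_Emor.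
  case: eqP => [[il jl]|]; last by rewrite andbF mulr0.
  by rewrite il jl eqxx in ij.
rewrite -{j}ji in ij_s *.
rewrite (bigD1_seq i) ?undup_uniq //= ?mem_undup; last exact: (map_f fst ij_s).
rewrite coef_Emor lexx eqxx mulr1 big1 ?addr0 // => l li.
by rewrite coef_Emor xpair_eqE [i == l]eq_sym (negbTE li) /= andbF mulr0.
Qed.

End IdentitySubalgebra.

Section Comparison.
Variables (k : fieldType) (d : Order.disp_t) (P : porderType d).
Variable lf : locally_finite P.
Local Notation kP := (incidence_alg k lf).
Local Notation CP := (simplicial_mult_operad k P).

Definition relative_hochschild_operad : mult_operad k :=
  hochschild_mult_operad (@identity_subalg k d P lf).

Local Notation CkP := relative_hochschild_operad.

Lemma vertex_simplex_subproof (x : P) (i j : 'I_1) :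
  (i <= j)%N -> ((fun=> x) i <= (fun=> x : P) j)%O.
Proof. by []. Qed.

Definition vertex_simplex (x : P) : simplex P 0 :=
  Simplex (vertex_simplex_subproof x).

(* the composable tuple $(E^{v_0v_1}, \ldots, E^{v_{n-1}v_n})$ *)
Definition morphism_tuple n (v : simplex P n) : 'I_n -> kP :=
  fun l => Emor k (v (widen_ord (leqnSn n) l)) (v (lift ord0 l)).

Definition is_Phi (Phi : forall n, CP n -> CkP n) : Prop :=
  (forall (f : cochain k P 0) (a : 'I_0 -> kP),
     (Phi 0%N f : hochschild _ 0) a = diag_sum (fun i => f (vertex_simplex i))) /\
  (forall n (f : cochain k P n.+1) (v : simplex P n.+1),
     (Phi n.+1 f : hochschild _ n.+1) (morphism_tuple v) =
       f v *: Emor k (v ord0) (v ord_max)).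

End Comparison.

Arguments relative_hochschild_operad k {d P} lf.

(* Main.v *)
(* For a simplex [v] let [G F v] be the coefficient of [E^(v_0 v_n)] in
   [F(E^(v_0 v_1), ..., E^(v_(n-1) v_n))]; this makes sense in degree 0 too, and
   [Phi] is the inverse of [G]. If [b_0, ..., b_n] are diagonal and
   [b_i a_i = a'_i b_(i+1)] for all [i], then S-relativity of [F] gives
   [b_0 F(a) = F(a') b_n]. Taking the [b_i] to be vertex idempotents shows that
   [G] is compatible with compositions; taking them all to be the indicator of
   the elements above [x], or of those below [y], shows that the coefficient
   [(x, y)] of [F(a)] only depends on the finitely many coefficients of the
   [a_i] indexed by the interval [[x, y]], so that multilinearity makes [G]
   injective. A preimage of [f] under [G] sums [f] over the chains from [x] to
   [y], weighted by the products of the coefficients of the arguments. *)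

Require Import Defs.
From mathcomp Require Import all_boot all_order all_algebra.
From mathcomp Require Import all_classical.

Set Implicit Arguments.
Unset Strict Implicit.
Unset Printing Implicit Defensive.

Import Order.TTheory GRing.Theory.
Local Open Scope ring_scope.

(** * Intertwining and multilinear expansion for relative cochains of any algebra *)

Section RelativeCochainTheory.
Variables (k : fieldType) (A : assoc_alg k) (S : set A) (n : nat).
Variables (f : ('I_n -> A) -> A) (fP : rel_cochain S f).

(* Push [b_0] rightwards through the arguments of [f]. *)
Lemma rel_cochain_intertwine (a a' : 'I_n -> A) (b : nat -> A) :
    (forall i, S (b i)) -> (forall i : 'I_n, b i ** a i = a' i ** b i.+1) ->
  b 0%N ** f a = f a' ** b n.
Proof.
(* After [m] steps the first [m] arguments are replaced and [b m] sits in the gap before argument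
   [m]. *)
move=> Sb ab; pose c m (i : 'I_n) := if (i < m)%N then a' i else a i.
have step m : (m <= n)%N -> b 0%N ** f a = gap_l f (c m) m (b m).
  elim: m => [_|m IH mn].
    by rewrite (rel_gap _ fP) //=; congr (_ ** f _); apply: funext.
  pose i := Ordinal mn.
  have -> := rel_gap (c m.+1) fP (Sb m.+1) mn.
  have -> := gap_rE f (c m.+1) i (b m.+1).
  have -> := IH (ltnW mn).
  have -> := gap_lE f (c m) i (b m).
  congr f; apply: funext => j; rewrite /upd /c ltnS.
  case: eqVneq => [_|ji]; first by rewrite /= ltnn leqnn (ab i).
  by rewrite ltnS [(j <= m)%N]leq_eqVlt (negbTE ji : (j == m :> nat) = false).
rewrite (step n) // gap_l_last; congr (f _ ** _).
by apply: funext => i; rewrite /c ltn_ord.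
Qed.

Lemma rel_cochainZ (c : 'I_n -> k) (a : 'I_n -> A) :
  f (fun i => c i *: a i) = (\prod_i c i) *: f a.
Proof.
have fZ (x : k) a' i : f (upd a' i (x *: a' i)) = x *: f a'.
  have := rel_linear fP a' i x (a' i) 0; rewrite addr0 => ->.
  (* Linearity at [-1], [0], [0] says that [f] vanishes when an argument is 0. *)
  have := rel_linear fP a' i (-1) 0 0.
  rewrite scaler0 addr0 scaleN1r addNr => ->; rewrite addr0.
  by congr (_ *: f _); apply: funext => j; rewrite /upd; case: eqP => [->|].
pose e m (i : 'I_n) := if (i < m)%N then c i *: a i else a i.
have step m : (m <= n)%N -> f (e m) = (\prod_(i < n | (i < m)%N) c i) *: f a.
  elim: m => [_|m IH mn]; first by rewrite big_pred0 // scale1r.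
  pose i := Ordinal mn.
  have -> : \prod_(j < n | (j < m.+1)%N) c j =
      c i * \prod_(j < n | (j < m)%N) c j.
    rewrite (bigD1 i) //=; congr (_ * _); apply: eq_bigl => j.
    by rewrite ltnS -(inj_eq val_inj) /= [RHS]ltn_neqAle andbC.
  rewrite -scalerA; have <- := IH (ltnW mn); have <- := fZ (c i) (e m) i.
  congr f; apply: funext => j; rewrite /upd /e; case: eqVneq => [->|ji].
    by rewrite /= ltnn leqnn.
  by rewrite ltnS [(j <= m)%N]leq_eqVlt (negbTE ji : (j == m :> nat) = false).
transitivity (f (e n)).
  by congr f; apply: funext => i; rewrite /e ltn_ord.
by rewrite step //; congr (_ *: _); apply: eq_bigl => i; rewrite ltn_ord.
Qed.

Lemma rel_cochain0 (a : 'I_n -> A) (i : 'I_n) : a i = 0 -> f a = 0.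
Proof.
move=> ai; have := rel_linear fP a i (-1) 0 0.
rewrite scaler0 addr0 scaleN1r addNr => <-.
by congr f; apply: funext => j; rewrite /upd; case: eqP => [->|].
Qed.

(** Multilinear expansion, one argument at a time: [e m p] has sums in the first [m] slots and the
    spanning elements [E (p i)] in the others. *)
Lemma rel_cochain_span (I : Type) (E : I -> A) (l : A -> k^o)
    (r : seq I) (j0 : I) (c : 'I_n -> I -> k) :
  linear l -> (forall p : 'I_n -> I, l (f (fun i => E (p i))) = 0) ->
  l (f (fun i => \sum_(j <- r) c i j *: E j)) = 0.
Proof.
move=> llin lE.
have l0 : l 0 = 0.
  by have := llin (-1) 0 0; rewrite scaler0 addr0 scaleN1r addNr.
pose e m (p : 'I_n -> I) (i : 'I_n) :=
  if (i < m)%N then \sum_(j <- r) c i j *: E j else E (p i).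
have step m p : (m <= n)%N -> l (f (e m p)) = 0.
  elim: m p => [|m IH] p mn; first exact: lE.
  pose i := Ordinal mn.
  have -> : e m.+1 p = upd (e m p) i (\sum_(j <- r) c i j *: E j).
    apply: funext => j; rewrite /upd /e; case: eqVneq => [->|ji].
      by rewrite /= leqnn.
    by rewrite ltnS [(j <= m)%N]leq_eqVlt (negbTE ji : (j == m :> nat) = false).
  (* Only the list in slot [m] is generalised; the earlier slots keep the full [r]. *)
  elim: (X in \sum_(_ <- X) _) => [|j s IHs].
    by rewrite big_nil (@rel_cochain0 _ i) // upd_same.
  rewrite big_cons (rel_linear fP) llin IHs addr0.
  have -> : upd (e m p) i (E j) = e m (upd p i j).
    apply: funext => h; rewrite /upd /e; case: eqVneq => [->|//].
    by rewrite /= ltnn.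
  by rewrite IH ?scaler0 // ltnW.
transitivity (l (f (e n (fun=> j0)))); last exact: step.
by congr (l (f _)); apply: funext => i; rewrite /e ltn_ord.
Qed.
End RelativeCochainTheory.

(** * Coefficients of relative cochains of the incidence algebra *)

Section RelativeIncidenceCochains.
Variables (k : fieldType) (d : Order.disp_t) (P : porderType d).
Variable lf : locally_finite P.
Local Notation kP := (incidence_alg k lf).
Local Notation S := (@identity_subalg k d P lf).

Local Notation itv x y :=
  (finmap.enum_fset (fset_set [set z : P | (x <= z <= y)%O]%classic)).

Lemma mem_itv x y z : (z \in itv x y) = (x <= z <= y)%O.
Proof. by rewrite in_fset_set //; apply/idP/idP; rewrite inE. Qed.

Lemma coef_diag_amul (b : P -> k) (a : kP) x y :
  coef ((diag_sum b : kP) ** a) x y = b x * coef a x y.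
Proof.
have [xy|xy] := boolP (x <= y)%O; last by rewrite !coef_out // mulr0.
rewrite (coef_mul lf _ a (lexx x) (lexx y)).
rewrite (bigD1_seq x) ?mem_itv ?lexx ?finmap.fset_uniq //=.
rewrite coef_diag eqxx big1 ?addr0 // => z zx.
by rewrite coef_diag eq_sym (negbTE zx) mul0r.
Qed.

Lemma coef_amul_diag (b : P -> k) (a : kP) x y :
  coef (a ** (diag_sum b : kP)) x y = coef a x y * b y.
Proof.
have [xy|xy] := boolP (x <= y)%O; last by rewrite !coef_out // mul0r.
rewrite (coef_mul lf a _ (lexx x) (lexx y)).
rewrite (bigD1_seq y) ?mem_itv ?lexx ?xy ?finmap.fset_uniq //=.
rewrite coef_diag eqxx big1 ?addr0 // => z zy.
by rewrite coef_diag (negbTE zy) mulr0.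
Qed.

Lemma incidence_coef0 x y : coef (0 : incidence k P) x y = 0.
Proof. by rewrite /coef; case: insub. Qed.

Lemma incidence_coefZ c (a : incidence k P) x y :
  coef (c *: a) x y = c * coef a x y.
Proof. by rewrite -[c *: a]addr0 coef_lin incidence_coef0 addr0. Qed.

Lemma incidence_coef_sum (I : Type) (r : seq I) (F : I -> incidence k P) x y :
  coef (\sum_(i <- r) F i) x y = \sum_(i <- r) coef (F i) x y.
Proof.
elim: r => [|i r IH]; first by rewrite !big_nil incidence_coef0.
by rewrite !big_cons -[F i]scale1r coef_lin mul1r IH scale1r.
Qed.

(** [rel_cochain_intertwine] for diagonal elements, which lie in [S] by [identity_subalgP], read off
    coefficientwise. *)
Lemma coef_intertwine n (F : hochschild S n) (a a' : 'I_n -> kP)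
    (b : nat -> P -> k) :
    (forall (i : 'I_n) x y,
       b i x * coef (a i) x y = coef (a' i) x y * b i.+1 y) ->
  forall x y, b 0%N x * coef (F a) x y = coef (F a') x y * b n y.
Proof.
move=> ab x y; rewrite -coef_diag_amul -coef_amul_diag; congr (coef _ x y).
apply: (rel_cochain_intertwine (hochschildP F)
  (b := fun i => diag_sum (b i) : kP)).
  by move=> i; apply/identity_subalgP; exists (b i).
by move=> i; apply: coef_ext => u w _; rewrite coef_diag_amul coef_amul_diag.
Qed.

(** * The map [G] of values on simplices, and its compatibility with composition *)

Definition simplex_values n (F : hochschild S n) : cochain k P n :=
  fun v => coef (F (morphism_tuple k lf v)) (v ord0) (v ord_max).

Definition point (x : P) : P -> k := fun z => (z == x)%:R.

Lemma point_eq x : point x x = 1.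
Proof. by rewrite /point eqxx. Qed.

Lemma point_neq x z : z != x -> point x z = 0.
Proof. by rewrite /point => /negbTE ->. Qed.

(* [e_(v_0) F(a) = F(a') e_(v_n)], where [a'_i = c_i E^(v_i v_(i+1))], [c_i] is
   the coefficient of [a_i] in the product, and [e_x] is [diag_sum (point x)]. *)
Lemma coef_along_simplex n (F : hochschild S n) (v : simplex P n)
    (a : 'I_n -> kP) :
    (forall (i : 'I_n) z, z != v (lift ord0 i) ->
       coef (a i) (v (widen_ord (leqnSn n) i)) z = 0) ->
  forall y, coef (F a) (v ord0) y =
    (\prod_i coef (a i) (v (widen_ord (leqnSn n) i)) (v (lift ord0 i))) *
    (simplex_values F v * point (v ord_max) y).
Proof.
move=> a0 y.
pose c i := coef (a i) (v (widen_ord (leqnSn n) i)) (v (lift ord0 i)).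
pose b i := point (v (inord i)).
have bw (i : 'I_n) : b i = point (v (widen_ord (leqnSn n) i)).
  rewrite /b; congr (point (v _)); apply: val_inj.
  by rewrite /= inordK // ltnW // ltnS.
have bl (i : 'I_n) : b i.+1 = point (v (lift ord0 i)).
  by rewrite /b; congr (point (v _)); apply: val_inj; rewrite /= inordK // ltnS.
have b0 : b 0%N = point (v ord0).
  by rewrite /b; congr (point (v _)); apply: val_inj; rewrite /= inordK.
have bn : b n = point (v ord_max).
  by rewrite /b; congr (point (v _)); apply: val_inj; rewrite /= inordK.
(* Both sides are supported at [(v_i, v_(i+1))]: the left one by [a0], the right one because it is a
   multiple of [E^(v_i v_(i+1))]. *)
have ab (i : 'I_n) x z : b i x * coef (a i) x z =
    coef (c i *: morphism_tuple k lf v i : kP) x z * b i.+1 z.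
  rewrite bw bl incidence_coefZ coef_Emor /point xpair_eqE /c.
  have [->|xv] := eqVneq x; last by rewrite andbF mulr0 !mul0r.
  have [->|zv] := eqVneq z; last by rewrite mulr0 a0 ?mulr0.
  by rewrite mul1r !mulr1 vertex_mono ?mulr1 //= /bump add1n.
have := coef_intertwine F ab (v ord0) y.
rewrite b0 bn /point eqxx mul1r => ->.
rewrite (rel_cochainZ (hochschildP F)) incidence_coefZ -mulrA.
have [->//|] := eqVneq y (v ord_max).
by rewrite !mulr0.
Qed.

(** The case of [coef_along_simplex] where every [c_i] is 1: row [v_0] of the value is supported at
    [v_n]. *)
Lemma coef_morphism_tuple n (F : hochschild S n) (v : simplex P n) y :
  coef (F (morphism_tuple k lf v)) (v ord0) y =
    simplex_values F v * point (v ord_max) y.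
Proof.
have E (i : 'I_n) z : coef (morphism_tuple k lf v i : kP)
    (v (widen_ord (leqnSn n) i)) z = point (v (lift ord0 i)) z.
  rewrite coef_Emor xpair_eqE eqxx /= /point.
  have [->|_] := eqVneq; last by rewrite andbF.
  by rewrite andbT vertex_mono //= /bump add1n.
rewrite coef_along_simplex => [|i z zv]; last by rewrite E /point (negbTE zv).
by rewrite big1 ?mul1r // => i _; rewrite E /point eqxx.
Qed.

(** Each block runs between consecutive vertices of the outer face. Hence the arguments [G i (...)]
    of [F] satisfy the support condition of [coef_along_simplex] along that face, and the scalars
    [c_i] are the values of the [G i]. *)
Lemma simplex_values_gamma r (n : 'I_r -> nat) (F : hochschild S r)
    (G : forall i, hochschild S (n i)) :
  simplex_values (hochschild_gamma F G) =
    cochain_gamma (simplex_values F) (fun i => simplex_values (G i)).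
Proof.
apply: funext => v; rewrite /cochain_gamma /=.
have bE i : block_args (morphism_tuple k lf v) (i := i) =
    morphism_tuple k lf (block_face v i).
  apply: funext => q; rewrite /block_args /morphism_tuple.
  congr (Emor k _ _); apply/esym/block_faceE; first exact: RankE.
  by rewrite !lift0 RankE addnS.
have v0 i : block_face v i ord0 = outer_face v (widen_ord (leqnSn r) i).
  by apply: block_faceE; rewrite /= addn0.
have vn i : block_face v i ord_max = outer_face v (lift ord0 i).
  by apply: block_faceE; rewrite /= /bump add1n offsetS.
rewrite [LHS]/simplex_values.
have -> : v ord0 = outer_face v ord0.
  by apply/esym/outer_faceE; rewrite /= offset0.
have -> : v ord_max = outer_face v ord_max.
  by apply/esym/outer_faceE; rewrite /= offset_ge.
rewrite -[LHS]/(coef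
  (F (fun i => G i (block_args (morphism_tuple k lf v) (i := i))))
  (outer_face v ord0) (outer_face v ord_max)).
rewrite coef_along_simplex => [|i z zv]; last first.
  by rewrite bE -v0 coef_morphism_tuple vn (point_neq zv) mulr0.
rewrite point_eq mulr1 mulrC; congr (_ * _).
by apply: eq_bigr => i _; rewrite bE -v0 -vn.
Qed.

(** * Injectivity of [simplex_values] *)

Lemma simplex_steps n (w : 'I_n.+1 -> P) :
    (forall i : 'I_n, (w (widen_ord (leqnSn n) i) <= w (lift ord0 i))%O) ->
  forall i j : 'I_n.+1, (i <= j)%N -> (w i <= w j)%O.
Proof.
move=> wS i [j jn]; elim: j jn => [|j IH] jn /=.
  by rewrite leqn0 => /eqP i0; rewrite (_ : i = Ordinal jn) //; apply: val_inj.
rewrite leq_eqVlt => /orP[/eqP ij|].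
  by rewrite (_ : i = Ordinal jn) //; apply: val_inj.
rewrite ltnS => ij; apply: le_trans (IH (ltnW jn) ij) _.
have -> : Ordinal (ltnW jn) = widen_ord (leqnSn n) (Ordinal (jn : (j < n)%N)).
  exact: val_inj.
have -> : Ordinal jn = lift ord0 (Ordinal (jn : (j < n)%N)) by exact: val_inj.
exact: wS.
Qed.

(** Either some pair is unordered and its [Emor] is 0, or the tuple is not composable from [x] and
    vertex idempotents kill the coefficient, or the tuple comes from a simplex starting at [x]. *)
Lemma coef_Emor_tuple0 n (F : hochschild S n) (p : 'I_n -> P * P) x y :
  simplex_values F = 0 -> coef (F (fun i => Emor k (p i).1 (p i).2)) x y = 0.
Proof.
move=> F0; have Fa0 a i : a i = 0 -> coef (F a) x y = 0.
  by move=> /(rel_cochain0 (hochschildP F)) ->; exact: incidence_coef0.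
have [pP|/existsNP[i pi]] := pselect (forall i, ((p i).1 <= (p i).2)%O);
  last first.
  apply: (Fa0 _ i); apply: coef_ext => u w uw.
  rewrite incidence_coef0 coef_Emor uw xpair_eqE /=.
  by case: eqP pi => // <- pi; case: eqP => // wp; rewrite -wp in pi.
(* The candidate vertices: [x], followed by the targets of the pairs. *)
pose u (i : nat) : P :=
  if i is j.+1 then if insub j is Some o then (p o).2 else x else x.
have uS (i : 'I_n) : u i.+1 = (p i).2 by rewrite /u valK.
have [pu|/existsNP[i pi]] := pselect (forall i : 'I_n, (p i).1 = u i);
  last first.
  (* Multiplying by the idempotent at [u i] kills a morphism with another source; one such mismatch
     makes [a i] zero. *)
  pose a i : kP := ((p i).1 == u i)%:R *: Emor k (p i).1 (p i).2.
  have ab (j : 'I_n) z w : point (u j) z * coef (Emor k (p j).1 (p j).2) z w =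
      coef (a j) z w * point (u j.+1) w.
    rewrite uS incidence_coefZ coef_Emor /point xpair_eqE.
    have [->|] := eqVneq z (p j).1; last by rewrite !(andbF, mulr0, mul0r).
    by have [->|] := eqVneq w (p j).2; rewrite ?mulr1 // !(andbF, mulr0, mul0r).
  have := coef_intertwine F (b := fun i => point (u i)) ab x y.
  rewrite /point eqxx mul1r => ->.
  rewrite (Fa0 a i) ?mul0r // /a; move/eqP/negbTE: pi => ->.
  by rewrite scale0r.
pose w (i : 'I_n.+1) := u i.
have wS (i : 'I_n) : (w (widen_ord (leqnSn n) i) <= w (lift ord0 i))%O.
  by have := pP i; rewrite pu -uS /w lift0.
pose v := Simplex (simplex_steps wS).
have -> : (fun i => Emor k (p i).1 (p i).2 : kP) = morphism_tuple k lf v.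
  by apply: funext => i; rewrite /morphism_tuple /= /w lift0 uS pu.
have -> : x = v ord0 by [].
by rewrite coef_morphism_tuple F0 mul0r.
Qed.

Lemma simplex_values_eq0 n (F : hochschild S n) : simplex_values F = 0 -> F = 0.
Proof.
move=> F0; apply: hochschild_eq => a; apply: coef_ext => x y xy.
rewrite [RHS]incidence_coef0.
pose U z : k := (x <= z)%O%:R; pose D z : k := (z <= y)%O%:R.
pose aU i := (diag_sum U : kP) ** a i.
pose aUD i := aU i ** (diag_sum D : kP).
have -> : coef (F a) x y = coef (F aU) x y.
  (* The elements above [x] form an up-set, so a nonzero entry with row above [x] has its column
     above [x]. *)
  have abU (i : 'I_n) z w : U z * coef (a i) z w = coef (aU i) z w * U w.
    rewrite coef_diag_amul /U.
    have [xz|_] := boolP (x <= z)%O; last by rewrite !mul0r.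
    have [zw|/coef_out ->] := boolP (z <= w)%O; last by rewrite !(mulr0, mul0r).
    by rewrite (le_trans xz zw) mulr1.
  have := coef_intertwine F (b := fun=> U) abU x y.
  by rewrite /U lexx xy mul1r mulr1.
have -> : coef (F aU) x y = coef (F aUD) x y.
  (* Dually, the elements below [y] form a down-set. *)
  have abD (i : 'I_n) z w : D z * coef (aUD i) z w = coef (aU i) z w * D w.
    rewrite coef_amul_diag /D.
    have [wy|_] := boolP (w <= y)%O; last by rewrite !mulr0.
    have [zw|/coef_out ->] := boolP (z <= w)%O; last by rewrite !(mulr0, mul0r).
    by rewrite (le_trans zw wy) mul1r.
  have := coef_intertwine F (b := fun=> D) abD x y.
  by rewrite /D lexx xy mul1r mulr1.
(* Local finiteness makes this list available; it indexes all entries that survive both cuts. *)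
pose r := [seq (z, w) | z <- itv x y, w <- itv x y].
have rU : uniq r.
  by apply: allpairs_uniq => [||[? ?] [? ?]]; rewrite ?finmap.fset_uniq.
have -> : aUD = fun i => \sum_(p <- r) coef (a i) p.1 p.2 *: Emor k p.1 p.2.
  apply: funext => i; apply: coef_ext => z w zw.
  rewrite coef_amul_diag coef_diag_amul incidence_coef_sum.
  have pE (p : P * P) : coef (coef (a i) p.1 p.2 *: Emor k p.1 p.2) z w =
      if p == (z, w) then coef (a i) z w else 0.
    rewrite incidence_coefZ coef_Emor zw -surjective_pairing eq_sym.
    by case: eqP => [->|_]; rewrite ?mulr1 ?mulr0.
  rewrite (eq_bigr _ (fun p _ => pE p)).
  have [zwr|zwr] := boolP ((z, w) \in r).
    rewrite (bigD1_seq _ zwr rU) /= eqxx big1 ?addr0 => [|p /negbTE ->//].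
    have /allpairsP[[z' w'] /= [zI wI [-> ->]]] := zwr.
    move: zI wI; rewrite !mem_itv /U /D => /andP[-> _] /andP[_ ->].
    by rewrite mul1r mulr1.
  rewrite big1_seq => [|p /andP[_ pr]]; last first.
    by case: eqP pr zwr => // -> ->.
  rewrite /U /D; have [xz|_] := boolP (x <= z)%O; last by rewrite !mul0r.
  have [wy|_] := boolP (w <= y)%O; last by rewrite mulr0.
  case/negP: zwr; apply/allpairsP; exists (z, w); split=> //=; rewrite mem_itv.
    by rewrite xz (le_trans zw wy).
  by rewrite (le_trans xz zw).
apply: (rel_cochain_span (hochschildP F) (l := fun b : kP => coef b x y)
  (E := fun p : P * P => Emor k p.1 p.2 : kP) r (x, y)).
  by move=> c b b'; exact: coef_lin.
by move=> p; exact: coef_Emor_tuple0.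
Qed.

(** * Surjectivity of [simplex_values] by sums over chains *)

(* extended by 0 to the non-monotone sequences of vertices *)
Definition extend_cochain n (f : cochain k P n) (w : 'I_n.+1 -> P) : k :=
  if pselect (forall i j : 'I_n.+1, (i <= j)%N -> (w i <= w j)%O) is left h
  then f (Simplex h) else 0.

Lemma extend_cochainE n (f : cochain k P n) (v : simplex P n) :
  extend_cochain f v = f v.
Proof.
rewrite /extend_cochain; case: pselect => [h|]; last first.
  by case; exact: vertex_mono.
by congr f; apply: simplexP.
Qed.

Definition chain_term n (f : cochain k P n) (a : 'I_n -> kP)
    (w : 'I_n.+1 -> P) : k :=
  extend_cochain f w *
  \prod_i coef (a i) (w (widen_ord (leqnSn n) i)) (w (lift ord0 i)).

(** Ranging over all sequences in the interval gives a finite index type; those that are not chains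
    contribute 0. In degree 0 the end conditions force a diagonal element. *)
Definition chain_sum n (f : cochain k P n) (a : 'I_n -> kP) : kP :=
  fun p => \sum_(w : {ffun 'I_n.+1 -> seq_sub (itv (val p).1 (val p).2)} |
      (val (w ord0) == (val p).1) && (val (w ord_max) == (val p).2))
    chain_term f a (fun i => val (w i)).

Lemma coef_chain_sum n (f : cochain k P n) a x y : (x <= y)%O ->
  coef (chain_sum f a) x y =
    \sum_(w : {ffun 'I_n.+1 -> seq_sub (itv x y)} |
        (val (w ord0) == x) && (val (w ord_max) == y))
      chain_term f a (fun i => val (w i)).
Proof.
move=> xy; rewrite (coef_fun (fun x y =>
  \sum_(w : {ffun 'I_n.+1 -> seq_sub (itv x y)} |
      (val (w ord0) == x) && (val (w ord_max) == y))
  chain_term f a (fun i => val (w i)))).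
by rewrite xy.
Qed.

Lemma chain_term_upd n (f : cochain k P n) a (i : 'I_n) (b : kP) w :
  chain_term f (upd a i b) w =
    coef b (w (widen_ord (leqnSn n) i)) (w (lift ord0 i)) *
    (extend_cochain f w * \prod_(j | j != i)
       coef (a j) (w (widen_ord (leqnSn n) j)) (w (lift ord0 j))).
Proof.
rewrite /chain_term (bigD1 i) //= upd_same mulrCA; congr (_ * (_ * _)).
by apply: eq_bigr => j ji; rewrite upd_other.
Qed.

Lemma chain_term_upd_scale n (f : cochain k P n) a (i : 'I_n) (b : kP) c w :
  coef b (w (widen_ord (leqnSn n) i)) (w (lift ord0 i)) =
    c * coef (a i) (w (widen_ord (leqnSn n) i)) (w (lift ord0 i)) ->
  chain_term f (upd a i b) w = c * chain_term f a w.
Proof.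
move=> bE; rewrite chain_term_upd bE -mulrA -chain_term_upd.
congr (_ * chain_term _ _ _); apply: funext => j.
by rewrite /upd; case: eqP => [->|].
Qed.

Lemma chain_sum_rel n (f : cochain k P n) : rel_cochain S (chain_sum f).
Proof.
apply: gap_rel => [a i c b b'|a p b /identity_subalgP[t ->] pn].
  apply: coef_ext => x y xy; rewrite coef_lin !coef_chain_sum //.
  rewrite big_distrr -big_split /=; apply: eq_bigr => w _.
  by rewrite !chain_term_upd coef_lin mulrDl -!mulrA.
apply: coef_ext => x y xy.
(* both insertions weight the chain [w] by [t (w p)] *)
transitivity (\sum_(w : {ffun 'I_n.+1 -> seq_sub (itv x y)} |
    (val (w ord0) == x) && (val (w ord_max) == y))
  t (val (w (inord p))) * chain_term f a (fun i => val (w i))).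
  (* In the two outer gaps the value itself is multiplied, by [t y] or [t x]; the end conditions on
     [w] turn these into [t] at its last or first vertex. *)
  move: pn; rewrite leq_eqVlt => /orP[/eqP ->|pn].
    rewrite gap_l_last coef_amul_diag coef_chain_sum // mulrC big_distrr /=.
    apply: eq_bigr => w /andP[_ /eqP wy].
    congr (t _ * _); apply: etrans (esym wy) _.
    by congr (val (w _)); apply: val_inj; rewrite /= inordK.
  have -> := gap_lE (chain_sum f) a (Ordinal pn) (diag_sum t).
  rewrite coef_chain_sum //; apply: eq_bigr => w _.
  apply: chain_term_upd_scale; rewrite coef_diag_amul.
  congr (t (val (w _)) * _).
  by apply: val_inj; rewrite /= inordK // ltnW.
apply/esym; case: p pn => [|p] pn.
  rewrite /gap_r coef_diag_amul coef_chain_sum // big_distrr /=.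
  apply: eq_bigr => w /andP[/eqP wx _];
  congr (t _ * _); apply: etrans (esym wx) _.
  by congr (val (w _)); apply: val_inj; rewrite /= inordK.
have -> := gap_rE (chain_sum f) a (Ordinal pn) (diag_sum t).
rewrite coef_chain_sum //; apply: eq_bigr => w _.
apply: chain_term_upd_scale; rewrite coef_amul_diag mulrC.
congr (t (val (w _)) * _).
by apply: val_inj; rewrite /= inordK.
Qed.

Definition of_simplex_values n (f : cochain k P n) : hochschild S n :=
  mk_hochschild (chain_sum_rel f).

(** On the morphism tuple of [v] the only sequence with a nonzero term allowed is [v] itself. *)
Lemma of_simplex_valuesK n : cancel (@of_simplex_values n) (@simplex_values n).
Proof.
move=> f; apply: funext => v; rewrite /simplex_values.
set x := v ord0; set y := v ord_max.
have xvy i : (x <= v i <= y)%O by rewrite !vertex_mono //= -ltnS.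
have xy : (x <= y)%O by apply: vertex_mono.
have vI i : v i \in itv x y by rewrite mem_itv.
pose w0 : {ffun 'I_n.+1 -> seq_sub (itv x y)} := [ffun i => SeqSub (vI i)].
have w0E : (fun i => val (w0 i)) = v by apply: funext => i; rewrite ffunE.
have -> := coef_chain_sum f (morphism_tuple k lf v) xy.
have w0P : (val (w0 ord0) == x) && (val (w0 ord_max) == y).
  by rewrite !ffunE !eqxx.
rewrite (bigD1 w0) //= w0E big1 ?addr0 => [|w /andP[/andP[/eqP wx _] ww0]].
  rewrite /chain_term extend_cochainE big1 ?mulr1 // => i _.
  by rewrite coef_Emor eqxx andbT vertex_mono //= /bump add1n.
(* Since [w] starts at [v_0], it can differ from [v] only at some [v_(i+1)], where the coefficient
   of [E^(v_i v_(i+1))] vanishes. *)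
have [wS|/existsNP[i wi]] := pselect (forall i : 'I_n,
    val (w (lift ord0 i)) = v (lift ord0 i)).
  case/eqP: ww0; apply/ffunP => i; apply: val_inj; rewrite ffunE /=.
  by case: (unliftP ord0 i) => [j ->|->]; [exact: wS|exact: wx].
rewrite /chain_term (bigD1 i) //= coef_Emor xpair_eqE.
by move/eqP/negbTE: wi => ->; rewrite !andbF mul0r mulr0.
Qed.

(** * Linearity, bijectivity, identity, multiplication and the formulas for [Phi] *)

Lemma simplex_values_linear n : linear (@simplex_values n).
Proof.
move=> c F G; apply: funext => v.
pose m := morphism_tuple k lf v.
have E : (c *: F + G : hochschild S n) m = c *: F m + G m by [].
rewrite /simplex_values -/m.
have -> := congr1 (fun b => coef b (v ord0) (v ord_max)) E.
have -> := coef_lin c (F m) (G m) (v ord0) (v ord_max).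
by [].
Qed.

Lemma simplex_values_inj n : injective (@simplex_values n).
Proof.
move=> F G FG; apply/eqP; rewrite -subr_eq0; apply/eqP/simplex_values_eq0.
by rewrite -[F - G]addrC -scaleN1r simplex_values_linear FG scaleN1r addNr.
Qed.

(** A right inverse of an injective map is also a left inverse. *)
Lemma simplex_valuesK n : cancel (@simplex_values n) (@of_simplex_values n).
Proof. by move=> F; apply: simplex_values_inj; exact: of_simplex_valuesK. Qed.

Lemma simplex_values_id :
  simplex_values (hochschild_id S) = @cochain_id k d P.
Proof.
apply: funext => v; rewrite /simplex_values coef_Emor /cochain_id.
rewrite (_ : widen_ord _ _ = ord0); last exact: val_inj.
rewrite (_ : lift _ _ = ord_max); last exact: val_inj.
by rewrite eqxx vertex_mono.
Qed.

(** In the product of the two morphisms only the middle vertex [v_1] contributes. *)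
Lemma simplex_values_mul :
  simplex_values (hochschild_mul S) = @cochain_mul k d P.
Proof.
apply: funext => v; rewrite /simplex_values /cochain_mul.
pose o1 : 'I_3 := inord 1.
have o1E : (widen_ord (leqnSn 2) ord_max = o1) * (lift ord0 (ord0 : 'I_2) = o1).
  by split; apply: val_inj; rewrite /= inordK.
have o0E : widen_ord (leqnSn 2) ord0 = ord0 by exact: val_inj.
have o2E : lift ord0 (ord_max : 'I_2) = ord_max by exact: val_inj.
have [v01 v12] : (v ord0 <= v o1)%O /\ (v o1 <= v ord_max)%O.
  by split; apply: vertex_mono; rewrite /= ?inordK.
have -> := coef_mul lf (morphism_tuple k lf v ord0)
  (morphism_tuple k lf v ord_max) (lexx (v ord0)) (lexx (v ord_max)).
rewrite (bigD1_seq (v o1)) ?finmap.fset_uniq ?mem_itv ?v01 //=.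
rewrite !coef_Emor !o1E o0E o2E v01 v12 !eqxx mulr1 big1 ?addr0 // => z zv.
by rewrite coef_Emor o1E xpair_eqE (negbTE zv) !andbF mul0r.
Qed.

Lemma is_Phi_of_simplex_values : is_Phi (@of_simplex_values : forall n,
  simplicial_mult_operad k P n -> relative_hochschild_operad k lf n).
Proof.
split=> [f a|n f v]; apply: coef_ext => x y xy.
  (* The empty tuple is the morphism tuple of every vertex, so each row [x] can be read off at
     [x]. *)
  have -> : a = morphism_tuple k lf (vertex_simplex x) by apply: funext => -[].
  rewrite (coef_morphism_tuple _ (vertex_simplex x)) of_simplex_valuesK.
  rewrite coef_diag.
  by rewrite /point eq_sym; case: eqP; rewrite ?mulr1 ?mulr0.
rewrite incidence_coefZ coef_Emor xy xpair_eqE.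
have [->|xv] := eqVneq x (v ord0).
  by rewrite coef_morphism_tuple of_simplex_valuesK /point.
rewrite mulr0; set F := of_simplex_values f.
(* The first morphism absorbs the idempotent at [v_0] on its left, so all rows other than [v_0]
   vanish. *)
pose b i := if i is 0%N then point (v ord0) else fun=> 1.
have mb (i : 'I_n.+1) u w : b i u * coef (morphism_tuple k lf v i : kP) u w =
    coef (morphism_tuple k lf v i : kP) u w * b i.+1 w.
  rewrite /= mulr1; case: i => -[|i] i_n /=; last by rewrite mul1r.
  have [->|uv] := eqVneq u (v ord0); first by rewrite point_eq mul1r.
  rewrite (point_neq uv) mul0r coef_Emor xpair_eqE (_ : widen_ord _ _ = ord0).
    by rewrite (negbTE uv) andbF.
  exact: val_inj.
have := coef_intertwine F (b := b) mb x y.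
by rewrite /= point_neq // mul0r mulr1.
Qed.

End RelativeIncidenceCochains.

(** * Uniqueness of [Phi] and the isomorphism of operads with multiplication *)

Theorem theorem2p2 (k : fieldType) (char0 : [pchar k] =i pred0)
    (d : Order.disp_t) (P : porderType d) (lf : locally_finite P) :
  exists Phi : forall n, simplicial_mult_operad k P n ->
                         relative_hochschild_operad k lf n,
    unique (@is_Phi k d P lf) Phi /\ is_mult_operad_iso Phi.
Proof.
pose G n : relative_hochschild_operad k lf n -> simplicial_mult_operad k P n :=
  @simplex_values k d P lf n.
pose Phi n : simplicial_mult_operad k P n -> relative_hochschild_operad k lf n :=
  @of_simplex_values k d P lf n.
have GK n : cancel (G n) (Phi n) by exact: simplex_valuesK.
have PhiK n : cancel (Phi n) (G n) by exact: of_simplex_valuesK.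
have Gmorph : is_operad_morphism G.
  split=> [n||r n F F'].
  - exact: simplex_values_linear.
  - exact: simplex_values_id.
  - exact: simplex_values_gamma.
exists Phi; split.
  split; first exact: is_Phi_of_simplex_values.
  (* The defining formulas make [Psi] a right inverse of the injective [G]. *)
  move=> Psi [Psi0 PsiS]; apply: functional_extensionality_dep => n.
  apply: funext => f; apply: (can_inj (GK n)); rewrite PhiK; apply: funext => v.
  case: n f v => [|n] f v.
    rewrite /G /simplex_values Psi0 coef_diag (_ : ord_max = ord0) ?eqxx //.
      by congr f; apply: simplexP => i; rewrite ord1.
    exact: val_inj.
  rewrite /G /simplex_values PsiS incidence_coefZ coef_Emor eqxx.
  by rewrite vertex_mono // mulr1.
split.
  split; last by exists G.
  (* The morphism axioms pass from [G] to its inverse. *)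
  case: Gmorph => Glin Gid Ggamma; split=> [n c f f'||r n f g].
  - by apply: (can_inj (GK n)); rewrite Glin !PhiK.
  - by apply: (can_inj (GK 1%N)); rewrite PhiK Gid.
  - apply: (can_inj (GK _)); rewrite PhiK Ggamma PhiK; congr op_gamma.
    by apply: functional_extensionality_dep => i; rewrite PhiK.
by rewrite -[RHS]GK; congr (Phi _ _); apply/esym/simplex_values_mul.
Qed.
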